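(* Let $I_1,\ldots,I_m$ be finite multisets of elements of $\mathcal I$. Then, in $\mathbb R[x^{\mathcal I}]$, $$x^{I_1}\diamond\cdots\diamond x^{I_m}=\sum_{(\pi,K)\in\mathcal D_{\mathrm{NF}}(I_1,\ldots,I_m)}(-1)^{|\pi|}\,\kappa[X]^\pi\,x^{K}.$$
   Context: Let $(X^i)_{i\in\mathcal I}$ be a collection of real random variables on a probability space, all of whose mixed moments are finite, and let $(x^i)_{i\in\mathcal I}$ be commuting indeterminates, generating the polynomial algebra $\mathbb R[x^{\mathcal I}]$. For a finite multiset $I=\{i_1,\ldots,i_n\}$ of elements of $\mathcal I$ put $x^I=x^{i_1}\cdots x^{i_n}$, and let $\kappa[X^I]=\kappa[X^{i_1},\ldots,X^{i_n}]$ be the joint cumulant. Elements of a multiset, counted with multiplicity, are treated as distinguishable nodes: sums over $J\subset I$ run over all $2^{|I|}$ subsets of nodes, and $\mathcal P(I)$ is the set of partitions of the set of nodes of $I$ into non-empty blocks ($\mathcal P(\varnothing)=\{\varnothing\}$). For a partition $\pi$ put $\kappa[X]^\pi=\prod_{J\in\pi}\kappa[X^J]$, with $\kappa[X]^\varnothing=1$; $|\pi|$ is the number of blocks. Appell polynomials: $x^{\diamond I}=\sum_{J\subset I}x^J\sum_{\pi\in\mathcal P(I\setminus J)}(-1)^{|\pi|}\kappa[X]^\pi$, with $x^{\diamond\varnothing}=1$. They form a linear basis of $\mathbb R[x^{\mathcal I}]$. The Wick product $\diamond$ is the bilinear (commutative, associative) product on $\mathbb R[x^{\mathcal I}]$ determined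 by $x^{\diamond I}\diamond x^{\diamond J}=x^{\diamond(I\sqcup J)}$. Diagrams: given rows $I_1,\ldots,I_m$, let $I=I_1\sqcup\cdots\sqcup I_m$ (disjoint union of nodes). A diagram is a pair $(\pi,K)$ with $K\subset I$ a subset of nodes and $\pi\in\mathcal P(I\setminus K)$. It is non-flat if no block of $\pi$ is contained in a single row ($K$ is allowed to lie in a single row). $\mathcal D_{\mathrm{NF}}(I_1,\ldots,I_m)$ is the set of non-flat diagrams. *)

(* Defs.v *)
From HB Require Import structures.
From mathcomp Require Import all_boot all_order all_algebra finmap multiset.
From mathcomp Require Import all_classical all_reals all_analysis.
(* The notations of monalg are incompatible with those of mathcomp-analysis. *)
From mathcomp Require Import -(notations) monalg.

Set Implicit Arguments.
Unset Strict Implicit.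
Unset Printing Implicit Defensive.

Import Order.TTheory GRing.Theory Num.Theory.
Local Open Scope mset_scope.
Local Open Scope ring_scope.

(* Commutative polynomials over R in the indeterminates I (not necessarily
   finitely many), written {malg R[{cmonom I}]} in monalg. *)
Notation polyalg R I := (malg (cmonom I) R).

Definition indet (R : realType) (I : choiceType) (i : I) : polyalg R I :=
  mkmalgU (ucm i) 1.

(* The monomial of a finite multiset. *)
Definition mpow (R : realType) (I : choiceType) (A : {mset I}) : polyalg R I :=
  \prod_(i <- A) indet R i.

(* Multiset elements counted with multiplicity, made distinguishable; the node
   v of A is an occurrence of the element label v. *)
Definition node (I : choiceType) (A : {mset I}) : finType := 'I_(size A).

Definition label (I : choiceType) (A : {mset I}) (v : node A) : I :=
  tnth (in_tuple A) v.

Definition node_sum (I : choiceType) (m : nat) (A : 'I_m -> {mset I}) : finType :=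
  {k : 'I_m & node (A k)}.

Definition label_sum (I : choiceType) (m : nat) (A : 'I_m -> {mset I})
    (v : node_sum A) : I := label (tagged v).

(* The monomial of a set K of nodes carrying labels l. *)
Definition npow (R : realType) (I : choiceType) (V : finType) (l : V -> I)
    (K : {set V}) : polyalg R I := \prod_(v in K) indet R (l v).

Section Cumulants.
Context (d : measure_display) (T : measurableType d) (R : realType).
Context (P : probability T R).

Definition finite_mixed_moments (I : choiceType) (X : I -> {RV P >-> R}) : Prop :=
  forall A : {mset I}, (fun w => \prod_(i <- A) X i w) \in Lfun P 1%E.

Definition joint_moment (V : finType) (Y : V -> {RV P >-> R}) (J : {set V}) : R :=
  fine 'E_P[fun w => \prod_(v in J) Y v w].

(* Joint cumulant of the family (Y v)_{v in J}, J nonempty, in terms of the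
   joint moments (Leonov-Shiryaev formula). *)
Definition joint_cumulant (V : finType) (Y : V -> {RV P >-> R}) (J : {set V}) : R :=
  \sum_(pi : {set {set V}} | finset.partition pi J)
    (-1) ^+ (#|pi|.-1) * (#|pi|.-1)`!%:R * \prod_(B in pi) joint_moment Y B.

Definition kappa_part (V : finType) (Y : V -> {RV P >-> R})
    (pi : {set {set V}}) : R := \prod_(J in pi) joint_cumulant Y J.

Definition appell (I : choiceType) (X : I -> {RV P >-> R}) (A : {mset I}) :
    polyalg R I :=
  \sum_(J : {set node A})
    (\sum_(pi : {set {set node A}} | finset.partition pi (~: J))
       (-1) ^+ #|pi| * kappa_part (X \o @label I A) pi)
    *: npow R (@label I A) J.

Definition is_wick_product (I : choiceType) (X : I -> {RV P >-> R})
    (W : polyalg R I -> polyalg R I -> polyalg R I) : Prop :=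
  [/\ forall p, linear (W p),
      forall q, linear (W^~ q)
    & forall A B : {mset I},
        W (appell X A) (appell X B) = appell X (A `+` B)%mset].

End Cumulants.

(* A family of polynomials a k = x^k + (terms of lower degree), indexed by the
   monomials k, is a basis. *)
Section TriangularBasis.
Context (R : realType) (I : choiceType) (a : cmonom I -> polyalg R I).
Implicit Types (k : cmonom I) (f g p q : polyalg R I).

Definition basis_map g : polyalg R I := \sum_(k <- msupp g) mcoeff k g *: a k.

Lemma basis_map_mmap g : basis_map g = mmap malgC a g.
Proof. by rewrite mmapE; apply: eq_bigr => k _; rewrite mul_malgC. Qed.

Lemma basis_map_is_linear : linear basis_map.
Proof.
move=> c g g'; rewrite [LHS]basis_map_mmap mmapD -!basis_map_mmap.
congr (_ + _); rewrite basis_map_mmap (mmapEw (msuppZ_le _ _)) scaler_sumr.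
by apply: eq_bigr => k _; rewrite mcoeffZ mul_malgC scalerA.
Qed.

HB.instance Definition _ :=
  GRing.isLinear.Build R _ _ _ basis_map basis_map_is_linear.

Lemma basis_mapU k : basis_map (mkmalgU k 1) = a k.
Proof. by rewrite basis_map_mmap mmapU mul_malgC scale1r. Qed.

Context (a_low : forall k j,
  j \in msupp (a k - mkmalgU k 1) -> (mdeg j < mdeg k)%N).

Lemma mcoeff_triangular k j : (mdeg k <= mdeg j)%N ->
  mcoeff j (a k) = (k == j)%:R.
Proof.
move=> kj; rewrite -[a k](subrK (mkmalgU k 1)) mcoeffD mcoeffU1.
by rewrite mcoeff_outdom ?add0r //; apply/negP => /a_low; rewrite ltnNge kj.
Qed.

Lemma basis_map_inj : injective basis_map.
Proof.
apply: raddf_inj => g g0; apply/eqP; apply: contraT => gN0.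
have [k0 k0g] : exists k, k \in msupp g.
  by apply/fset0Pn; rewrite msupp_eq0.
pose Q n := [exists k : msupp g, mdeg (val k) == n].
have exQ : exists n, Q n.
  by exists (mdeg k0); apply/existsP; exists [` k0g]%fset.
have maxQ n : Q n -> (n <= \max_(k : msupp g) mdeg (val k))%N.
  by move=> /existsP[k /eqP <-]; apply: leq_bigmax.
case: (ex_maxnP exQ maxQ) => n /existsP[[k kg] /= /eqP kn] nmax.
have {nmax}kmax j : j \in msupp g -> (mdeg j <= mdeg k)%N.
  move=> jg; rewrite kn; apply: nmax; apply/existsP.
  by exists [` jg]%fset.
have: mcoeff k (basis_map g) = 0 by rewrite g0 mcoeff0.
rewrite raddf_sum (bigD1_seq k) //= big_seq_cond big1 ?addr0.
  rewrite mcoeffZ mcoeff_triangular // eqxx mulr1 => /eqP.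
  by rewrite mcoeff_eq0 kg.
move=> j /andP[jg jk].
by rewrite mcoeffZ mcoeff_triangular ?kmax // (negPf jk) mulr0.
Qed.

Lemma basis_map_surj q : exists g, basis_map g = q.
Proof.
have comb (s : seq (cmonom I)) (c : cmonom I -> R) :
    {in s, forall k, exists g, basis_map g = mkmalgU k 1} ->
    exists g, basis_map g = \sum_(k <- s) c k *: mkmalgU k 1.
  elim: s => [|k s IH] sP; first by exists 0; rewrite big_nil linear0.
  have [g gE] := sP k (mem_head _ _).
  have [j js|g' g'E] := IH; first by apply: sP; rewrite inE js orbT.
  by exists (c k *: g + g'); rewrite big_cons basis_map_is_linear gE g'E.
have monE f : f = \sum_(k <- msupp f) mcoeff k f *: mkmalgU k 1.
  rewrite [LHS]monalgE; apply: eq_bigr => k _.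
  by apply/malgP => j; rewrite [LHS]mcoeffU mcoeffZ mcoeffU1 mulr_natr.
have mon_surj n k : (mdeg k < n)%N -> exists g, basis_map g = mkmalgU k 1.
  elim: n k => [//|n IH] k kn.
  have [j /a_low jk|g gE] := comb (msupp (a k - mkmalgU k 1))
      (fun j => mcoeff j (a k - mkmalgU k 1)).
    by apply: IH; apply: leq_trans jk _.
  by exists (mkmalgU k 1 - g); rewrite linearB /= gE -monE basis_mapU subKr.
rewrite (monE q); apply: comb => k _; exact: mon_surj (ltnSn _).
Qed.

Lemma basis_product : exists W : polyalg R I -> polyalg R I -> polyalg R I,
  [/\ forall p, linear (W p), forall q, linear (W^~ q)
    & forall k1 k2, W (a k1) (a k2) = a (mmul k1 k2)].
Proof.
have [Psi PsiK] := choice basis_map_surj.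
have PhiK : cancel basis_map Psi.
  by move=> g; apply: basis_map_inj; rewrite PsiK.
have Psi_lin : linear Psi.
  by move=> c p q; apply: basis_map_inj; rewrite PsiK basis_map_is_linear !PsiK.
exists (fun p q => basis_map (Psi p * Psi q)); split => [p c q q'|q c p p'|k1 k2].
- by rewrite Psi_lin mulrDr -scalerAr basis_map_is_linear.
- by rewrite Psi_lin mulrDl -scalerAl basis_map_is_linear.
have PsiE k : Psi (a k) = mkmalgU k 1 by rewrite -basis_mapU PhiK.
by rewrite (PsiE k1) (PsiE k2) malgM_def fgmulUU mulr1 basis_mapU.
Qed.

Lemma basis_ext (F G : polyalg R I -> polyalg R I) : linear F -> linear G ->
  (forall k, F (a k) = G (a k)) -> F =1 G.
Proof.
move=> Fl Gl FG p; have [g <-] := basis_map_surj p; rewrite /basis_map.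
have lin0 H : linear H -> H 0 = 0 :> polyalg R I.
  by move=> /(_ (-1) 0 0); rewrite scaler0 addr0 scaleN1r addNr.
elim: (X in \sum_(k <- X) _) => [|k s IH]; first by rewrite big_nil !lin0.
by rewrite big_cons Fl Gl FG IH.
Qed.

End TriangularBasis.

Section WickProduct.
Context (d : measure_display) (T : measurableType d) (R : realType).
Context (P : probability T R) (I : choiceType) (X : I -> {RV P >-> R}).
Implicit Types (A B : {mset I}) (k : cmonom I) (f g p q : polyalg R I).

(* Multisets over I and monomials of monalg are identified through cm and ms. *)
Let mon k : polyalg R I := mkmalgU k 1.
Let cm A : cmonom I := \big[mmul/mone]_(i <- A) ucm i.
Let ms k : {mset I} := cmonom_val k.

Let monM k1 k2 : mon k1 * mon k2 = mon (mmul k1 k2).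
Proof. by rewrite malgM_def fgmulUU mulr1. Qed.

Let mon_prod (S : Type) (r : seq S) (Q : pred S) (F : S -> cmonom I) :
  \prod_(i <- r | Q i) mon (F i) = mon (\big[mmul/mone]_(i <- r | Q i) F i).
Proof.
symmetry; apply: (big_morph mon) => [k1 k2|//].
by symmetry; apply: monM.
Qed.

Let cmE A i : cm A i = A i.
Proof.
rewrite -[RHS](count_mem_mset i A) /cm; elim: (enum_mset A) => [|x s IH].
  by rewrite big_nil cm1.
by rewrite big_cons cmM IH cmU.
Qed.

Let msK : cancel ms cm.
Proof. by move=> k; apply/eqP/cmP => i; rewrite cmE. Qed.

Let cmK : cancel cm ms.
Proof. by move=> A; apply/msetP => i; rewrite -[RHS]cmE. Qed.

Let cmD A B : cm (A `+` B) = mmul (cm A) (cm B).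
Proof. by apply/eqP/cmP => i; rewrite cmM !cmE msetE2. Qed.

Let a k : polyalg R I := appell X (ms k).

Let a_low k j : j \in msupp (a k - mon k) -> (mdeg j < mdeg k)%N.
Proof.
have npowE (J : {set node (ms k)}) : npow R (@label I (ms k)) J =
    mon (\big[mmul/mone]_(v in J) ucm (label v)) by exact: mon_prod.
have deg_npow (J : {set node (ms k)}) :
    mdeg (\big[mmul/mone]_(v in J) ucm (label v)) = #|J|.
  by rewrite mdeg_prod; under eq_bigr do rewrite mdegU; rewrite sum1_card.
have topE : \big[mmul/mone]_(v in [set: node (ms k)]) ucm (label v) = k.
  rewrite -[RHS]msK /cm [RHS]big_tnth.
  by apply: eq_bigl => v; rewrite finset.in_setT.
have degk : mdeg k = #|[set: node (ms k)]| by rewrite -{1}topE deg_npow.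
rewrite -mcoeff_neq0; apply: contraR; rewrite -leqNgt => lejk.
rewrite /a /appell (bigD1 [set: node (ms k)]) //= finset.setCT.
rewrite (big_pred1 finset.set0); last by move=> pi; rewrite partition_set0.
rewrite cards0 expr0 mul1r /kappa_part big_set0 scale1r npowE topE.
rewrite addrAC subrr add0r raddf_sum big1 // => J JT /=.
rewrite linearZ /= npowE mcoeffU; case: eqP => [jE|_]; last first.
  by rewrite mulr0n mulr0.
move: lejk; rewrite -jE deg_npow degk leqNgt.
by rewrite proper_card // finset.properT.
Qed.

Lemma wick_product_exists : exists W, is_wick_product X W.
Proof.
have [W [Wl Wr WE]] := basis_product a_low.
exists W; split => // A B; have := WE (cm A) (cm B).
by rewrite -cmD /a !cmK.
Qed.

Lemma wick_product_unique (W W' : polyalg R I -> polyalg R I -> polyalg R I) :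
  is_wick_product X W -> is_wick_product X W' -> W = W'.
Proof.
move=> [Wl Wr WE] [Wl' Wr' WE']; apply/funext => p; apply/funext => q.
apply: (basis_ext a_low (Wl p) (Wl' p)) => k2.
apply: (basis_ext a_low (Wr (a k2)) (Wr' (a k2))) => k1.
by rewrite /a WE WE'.
Qed.

End WickProduct.

Definition wick (d : measure_display) (T : measurableType d) (R : realType)
    (P : probability T R) (I : choiceType) (X : I -> {RV P >-> R}) :
    polyalg R I -> polyalg R I -> polyalg R I :=
  projT1 (cid (wick_product_exists X)).

Lemma wickP (d : measure_display) (T : measurableType d) (R : realType)
    (P : probability T R) (I : choiceType) (X : I -> {RV P >-> R}) :
  is_wick_product X (wick X).
Proof. exact: projT2 (cid (wick_product_exists X)). Qed.

(* Non-flat diagrams (pi, K): no block of pi lies in a single row. *)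
Definition diagramNF (I : choiceType) (m : nat) (A : 'I_m -> {mset I}) :
    {set {set {set node_sum A}} * {set node_sum A}} :=
  [set D | finset.partition D.1 (~: D.2) &
    [forall B in D.1, ~~ [exists k : 'I_m, [forall v in B, tag v == k]]]].

(* Main.v *)
Require Import Defs.
From HB Require Import structures.
From mathcomp Require Import all_boot all_order all_algebra finmap multiset.
From mathcomp Require Import all_classical all_reals all_analysis.
From mathcomp Require Import -(notations) monalg.
(* These two come last so that subsetP, set0, setTD and the like refer to finite
   sets and not to their namesakes on classical sets. *)
From mathcomp Require Import fintype finset.

(** Fix the set V of all nodes. For a weight f on blocks let M_f(S) be the sum,
    over the partitions of S, of the product of f over the blocks
    (partition_sum), and let
      E_f(S) = \sum_(J \subset S) M_f(S \ J) x^J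
    (partition_expansion). Write c for the joint cumulant. The polynomials in
    play are all of this form:
    - E_{-c}(S) is the Appell polynomial of the labels of S;
    - E_0(S) is the monomial x^S;
    - E_n(V), with n equal to -c on non-flat blocks and to 0 on flat ones, is
      the sum over non-flat diagrams.

    Two facts about partitions do the work. Expanding the product of f + g over
    the blocks, that is, marking each block of a partition with f or with g,
    gives M_{f+g}(S) = \sum_(T \subset S) M_f(T) M_g(S \ T)
    (partition_sumD), whence
      E_{f+g}(S) = \sum_(K \subset S) M_f(S \ K) E_g(K).
    And M_f(S1 U S2) = M_f(S1) M_f(S2) for disjoint S1, S2 as soon as f vanishes
    on the blocks that meet both (partition_sumU).

    Let f be c on flat blocks and 0 on the others, so that n = f - c. By the
    first fact E_n(S) is a combination of Appell polynomials E_{-c}(K), whose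
    Wick products are known: E_{-c}(K1) <> E_{-c}(K2) = E_{-c}(K1 U K2). By the
    second fact the coefficients multiply when S1 and S2 are unions of distinct
    rows, because a flat block lies in a single row. Hence
    E_n(S1) <> E_n(S2) = E_n(S1 U S2) (partition_expansionU). Inside one row
    every block is flat, so E_n(row) = E_0(row) is the monomial of that row, and
    multiplying the rows together yields E_n(V).

    It remains to identify E_{-c}(K), a sum over subsets of V, with the Appell
    polynomial of the multiset of labels of K, which is a sum over subsets of
    the nodes of that multiset. Both are transported along a label-preserving
    injection of those nodes into V with image K (appell_label_mset). *)

Set Implicit Arguments.
Unset Strict Implicit.
Unset Printing Implicit Defensive.

Import Order.TTheory GRing.Theory Num.Theory.
Local Open Scope mset_scope.
Local Open Scope ring_scope.

(** * Sums over set partitions *)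

Section PartitionSum.
Context (R : comNzRingType) (V : finType).
Implicit Types (f g : {set V} -> R) (S T : {set V}).
Implicit Types (rho sigma tau : {set {set V}}).

Lemma partition_setU S T sigma tau : T \subset S ->
  partition sigma T -> partition tau (S :\: T) -> partition (sigma :|: tau) S.
Proof.
move=> TS /and3P[/eqP covs trivs s0] /and3P[/eqP covt trivt t0].
apply/and3P; split; last by rewrite inE negb_or s0.
  rewrite /cover bigcup_setU -!/(cover _) covs covt setDE setUIr setUCr setIT.
  exact/eqP/setUidPr.
apply: trivIsetU => //; rewrite covs covt -setI_eq0.
by rewrite setDE setICA setICr setI0.
Qed.

Lemma partition_setD S rho sigma : partition rho S -> sigma \subset rho ->
  partition (rho :\: sigma) (S :\: cover sigma).
Proof.
move=> /and3P[/eqP covr trivr r0] sr; apply/and3P; split.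
- rewrite eqEsubset; apply/andP; split; apply/subsetP => x.
    case/bigcupP => B /setDP[Br Bs] xB; rewrite inE -covr.
    apply/andP; split; last by apply/bigcupP; exists B.
    apply/negP => /bigcupP[C Cs xC]; move: Bs.
    rewrite -(def_pblock trivr Br xB).
    by rewrite (def_pblock trivr (subsetP sr _ Cs) xC) Cs.
  rewrite inE -covr => /andP[xs /bigcupP[B Br xB]].
  apply/bigcupP; exists B => //; rewrite inE Br andbT.
  by apply: contra xs => Bs; apply/bigcupP; exists B.
- exact: trivIsetD.
- by rewrite inE negb_and r0 orbT.
Qed.

Lemma partition_sub S rho sigma : partition rho S -> sigma \subset rho ->
  partition sigma (cover sigma).
Proof.
move=> /and3P[_ trivr r0] sr; apply/and3P; split => //.
  exact: trivIsetS trivr.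
by apply: contra r0; apply: (subsetP sr).
Qed.

Lemma prodrD_subsets (I : finType) (A : {set I}) (F G : I -> R) :
  \prod_(i in A) (F i + G i) =
  \sum_(B : {set I} | B \subset A) \prod_(i in B) F i * \prod_(i in A :\: B) G i.
Proof.
(* Outside A the two summands are 0 and 1, so that only the subsets B of A
   contribute to the expansion over all subsets. *)
transitivity
  (\prod_i ((if i \in A then F i else 0) + (if i \in A then G i else 1))).
  rewrite big_mkcond; apply: eq_bigr => i _.
  by case: ifP => // _; rewrite add0r.
rewrite bigA_distr (bigID (fun B : {set I} => B \subset A)) /=.
rewrite [X in _ + X]big1 ?addr0; last first.
  move=> B /subsetPn[i iB iA].
  by rewrite (bigD1 i) //= iB (negPf iA) mul0r.
apply: eq_bigr => B BA.
rewrite [X in X * _]big_mkcond [X in _ * X]big_mkcond -big_split /=.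
apply: eq_bigr => i _; rewrite inE.
case: ifP => iB /=; first by rewrite (subsetP BA) // mulr1.
by rewrite mul1r.
Qed.

Definition partition_sum f S : R :=
  \sum_(pi | partition pi S) \prod_(B in pi) f B.

Lemma eq_partition_sum f g S :
  (forall B : {set V}, B != set0 -> B \subset S -> f B = g B) ->
  partition_sum f S = partition_sum g S.
Proof.
move=> fg; apply: eq_bigr => pi piS; apply: eq_bigr => B Bpi.
by apply: fg; [exact: partition_neq0 piS Bpi | exact: partitionS piS Bpi].
Qed.

Lemma partition_sum0 f : partition_sum f set0 = 1.
Proof.
rewrite /partition_sum (big_pred1 set0) ?big_set0 //.
by move=> pi; rewrite partition_set0.
Qed.

(** Every partition of S has a block through x, and that block contributes a
    zero factor. *)
Lemma partition_sum_eq0 f S x : x \in S ->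
  (forall B : {set V}, x \in B -> B \subset S -> f B = 0) -> partition_sum f S = 0.
Proof.
move=> xS f0; apply: big1 => pi piS.
have xc : x \in cover pi by rewrite (cover_partition piS).
have Bpi : pblock pi x \in pi by rewrite pblock_mem.
by rewrite (bigD1 (pblock pi x)) //= f0 ?mul0r ?mem_pblock //;
  apply: partitionS piS Bpi.
Qed.

(** Expanding the product over the blocks of rho amounts to splitting rho into
    sigma, weighted by f, and tau, weighted by g; then T is the union of the
    blocks of sigma. This is the addition rule for exponential generating
    functions. *)
Lemma partition_sumD f g S :
  partition_sum (fun B => f B + g B) S =
  \sum_(T : {set V} | T \subset S) partition_sum f T * partition_sum g (S :\: T).
Proof.
rewrite {1}/partition_sum.
under eq_bigr => rho rhoS.
  rewrite prodrD_subsets.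
  rewrite (partition_big cover (fun T => T \subset S)) /=; last first.
    move=> sigma sr; rewrite -(cover_partition rhoS).
    by apply/bigcupsP => B Bs; apply: bigcup_sup; apply: (subsetP sr).
  over.
rewrite exchange_big; apply: eq_bigr => T TS.
rewrite (exchange_big_dep (fun sigma => partition sigma T)) /=; last first.
  by move=> rho sigma rhoS /andP[sr /eqP <-]; apply: partition_sub rhoS sr.
rewrite /partition_sum mulr_suml; apply: eq_bigr => sigma sT.
(* For fixed sigma, the partitions rho containing it are the sigma :|: tau. *)
rewrite mulr_sumr (reindex_onto (fun tau => sigma :|: tau)
  (fun rho => rho :\: sigma)) /=; last first.
  move=> rho /andP[_ /andP[sr _]].
  by rewrite setDE setUIr setUCr setIT; apply/setUidPr.
have covs := cover_partition sT.
have disj tau : partition tau (S :\: T) -> (sigma :|: tau) :\: sigma = tau.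
  move=> tauS; rewrite setDUl setDv set0U; apply/setDidPl.
  rewrite -setI_eq0; apply/eqP/setP => B; rewrite !inE.
  apply/negP => /andP[Bt Bs]; have /set0Pn[x xB] := partition_neq0 sT Bs.
  have := subsetP (partitionS tauS Bt) x xB.
  by rewrite inE (subsetP (partitionS sT Bs)).
apply: eq_big => [tau | tau /andP[_ /eqP -> //]].
apply/idP/idP => [/andP[/andP[stS /andP[sst _]] /eqP <-]|tauS].
  by rewrite -covs; apply: partition_setD.
by rewrite (partition_setU TS) ?subsetUl ?covs ?disj ?eqxx.
Qed.

(** Split f into its part f1 on the blocks inside S1 and the remainder f2. In
    the resulting sum over T the term T = S1 alone survives: a node of T outside
    S1 lies in no f1-block, and a node of S1 outside T lies in no f2-block. *)
Lemma partition_sumU f S1 S2 : [disjoint S1 & S2] ->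
  (forall B : {set V}, B \subset S1 :|: S2 ->
     ~~ (B \subset S1) -> ~~ (B \subset S2) -> f B = 0) ->
  partition_sum f (S1 :|: S2) = partition_sum f S1 * partition_sum f S2.
Proof.
move=> S12 f0.
pose f1 (B : {set V}) := if B \subset S1 then f B else 0.
pose f2 (B : {set V}) := if B \subset S1 then 0 else f B.
have notS2 x (B : {set V}) : x \in S1 -> x \in B -> ~~ (B \subset S2).
  by move=> xS xB; apply/subsetPn; exists x => //; rewrite (disjointFr S12).
rewrite (@eq_partition_sum _ (fun B => f1 B + f2 B)); last first.
  by move=> B _ _; rewrite /f1 /f2; case: ifP; rewrite ?addr0 ?add0r.
rewrite partition_sumD (bigD1 S1) ?subsetUl //= big1 ?addr0.
  rewrite setDUl setDv set0U (setDidPl _) 1?disjoint_sym //.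
  congr (_ * _); apply: eq_partition_sum => B B0 BS.
    by rewrite /f1 BS.
  rewrite /f2; case: ifP => // BS1; case/negP: B0.
  rewrite -subset0; move: S12; rewrite -setI_eq0 => /eqP <-.
  by rewrite subsetI BS1.
move=> T /andP[TS TN]; have [TS1|] := boolP (T \subset S1); last first.
  case/subsetPn => x xT xS1.
  rewrite (partition_sum_eq0 xT) ?mul0r // => B xB _; rewrite /f1.
  by case: ifP => // /subsetP/(_ x xB); rewrite (negPf xS1).
have [x xS1 xT] : exists2 x, x \in S1 & x \notin T.
  apply/subsetPn; apply: contra TN => S1T.
  by rewrite eqEsubset TS1.
rewrite [X in _ * X](@partition_sum_eq0 _ _ x) ?mulr0 ?inE ?xT ?xS1 //.
move=> B xB BS; rewrite /f2; case: ifPn => // BS1.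
apply: f0 => //; last exact: notS2 xS1 xB.
exact: subset_trans BS (subsetDl _ _).
Qed.

Lemma reindex_partition_sum (U : finType) (h : U -> V) (hI : injective h)
    (M : nmodType) (F : {set {set V}} -> M) (S : {set U}) :
  \sum_(pi | partition pi (h @: S)) F pi =
  \sum_(pi | partition pi S) F [set h @: (B : {set U}) | B in pi].
Proof.
rewrite (reindex_onto
  (fun pi : {set {set U}} => [set h @: (B : {set U}) | B in pi])
  (fun rho : {set {set V}} => [set h @^-1: (B : {set V}) | B in rho])) /=.
  apply: eq_bigl => pi; rewrite imset_partition //.
  rewrite -imset_comp [X in X == _](_ : _ = pi) ?eqxx ?andbT //.
  rewrite -[RHS]imset_id; apply: eq_imset => B /=.
  by apply/setP => u; rewrite inE mem_imset.
move=> rho rhoS; rewrite -imset_comp -[RHS]imset_id.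
apply: eq_in_imset => B Brho /=; apply/setP => v.
apply/imsetP/idP => [[u] | vB]; first by rewrite inE => uB ->.
have /imsetP[u uS vE] := subsetP (partitionS rhoS Brho) _ vB.
by exists u; rewrite // inE -vE.
Qed.

End PartitionSum.

(** * Polynomials expanded over partitions of the complement *)

Section PartitionExpansion.
Context (R : comNzRingType) (V : finType) (M : lmodType R) (x : {set V} -> M).
Implicit Types (f g : {set V} -> R) (S K J : {set V}).

Definition partition_expansion f S : M :=
  \sum_(J : {set V} | J \subset S) partition_sum f (S :\: J) *: x J.

Lemma partition_expansion0 f S :
  (forall B : {set V}, B != set0 -> B \subset S -> f B = 0) ->
  partition_expansion f S = x S.
Proof.
move=> f0; rewrite /partition_expansion (bigD1 S) //= setDv partition_sum0.
rewrite scale1r big1 ?addr0 // => J /andP[JS JN].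
have /properP[_ [y yS yJ]] : J \proper S by rewrite properEneq JN.
rewrite (@partition_sum_eq0 _ _ _ _ y) ?scale0r ?inE ?yJ // => B yB BS.
apply: f0; first by apply/set0Pn; exists y.
exact: subset_trans BS (subsetDl _ _).
Qed.

(** Exchange the sums over J \subset K \subset S; with T = K \ J the coefficient
    of x J is the convolution computed by partition_sumD on S \ J. *)
Lemma partition_expansionD f g S :
  partition_expansion (fun B => f B + g B) S =
  \sum_(K : {set V} | K \subset S) partition_sum f (S :\: K) *:
    partition_expansion g K.
Proof.
rewrite /partition_expansion; symmetry.
under eq_bigr do rewrite scaler_sumr.
rewrite (exchange_big_dep (fun J => J \subset S)) /=; last first.
  by move=> K J KS JK; apply: subset_trans JK KS.
apply: eq_bigr => J JS.
under eq_bigr do rewrite scalerA.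
rewrite -scaler_suml partition_sumD; congr (_ *: _).
(* In partition_sumD the subset T carries f; here f sits on S :\: K, so T is
   S :\: K. *)
rewrite (reindex_onto (fun T => S :\: T) (fun K => S :\: K)) /=; last first.
  by move=> K /andP[KS _]; rewrite setDDr setDv set0U; apply/setIidPr.
apply: eq_big => [T|T /andP[_ /eqP ->]]; last first.
  by rewrite !setDDl setUC.
rewrite subsetDl /= subsetD JS /= subsetD.
rewrite setDDr setDv set0U disjoint_sym andbC.
by congr (_ && _); apply/eqP/setIidPr.
Qed.

End PartitionExpansion.

Lemma eq_partition_expansion (R : comNzRingType) (V : finType) (M : lmodType R)
    (x y : {set V} -> M) (f g : {set V} -> R) (S : {set V}) : x =1 y ->
  (forall B, B != set0 -> B \subset S -> f B = g B) ->
  partition_expansion x f S = partition_expansion y g S.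
Proof.
move=> xy fg; apply: eq_bigr => J _; rewrite xy; congr (_ *: _).
apply: eq_partition_sum => B B0 BS; apply: fg => //.
exact: subset_trans BS (subsetDl _ _).
Qed.

(** A diagram with a flat block has a zero factor, so the expansion over the
    whole set of nodes ranges over the non-flat diagrams only. *)
Lemma partition_expansionT_nonflat (R : comNzRingType) (V : finType)
    (M : lmodType R) (x : {set V} -> M) (flat : pred {set V})
    (c : {set V} -> R) :
  partition_expansion x (fun B => if flat B then 0 else - c B) setT =
  \sum_(D : {set {set V}} * {set V} |
      partition D.1 (~: D.2) && [forall B in D.1, ~~ flat B])
    ((-1) ^+ #|D.1| * \prod_(B in D.1) c B) *: x D.2.
Proof.
rewrite /partition_expansion /partition_sum.
under eq_bigr => J _ do rewrite setTD scaler_suml.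
rewrite (exchange_big_dep xpredT) //= pair_big_dep /=.
rewrite (bigID (fun D : {set {set V}} * {set V} =>
  [forall B in D.1, ~~ flat B])) /= [X in _ + X]big1 ?addr0; last first.
  move=> [pi J] /andP[_]; rewrite negb_forall.
  case/existsP => B; rewrite negb_imply negbK => /andP[Bpi Bf].
  by rewrite (bigD1 B) //= Bf mul0r scale0r.
apply: eq_big => [[pi J]|[pi J] /andP[_ /= /'forall_implyP nf]].
  by rewrite subsetT.
congr (_ *: _); rewrite -prodrN; apply: eq_bigr => B Bpi.
by rewrite ifN // nf.
Qed.

Lemma linear_sumZ (R : nzRingType) (M M' : lmodType R) (F : M -> M')
    (J : Type) (r : seq J) (P : pred J) (c : J -> R) (y : J -> M) : linear F ->
  F (\sum_(j <- r | P j) c j *: y j) = \sum_(j <- r | P j) c j *: F (y j).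
Proof.
move=> linF; elim: r => [|j r IH]; last first.
  by rewrite !big_cons; case: ifP => // _; rewrite linF IH.
rewrite !big_nil; have := linF (-1) 0 0.
by rewrite scaler0 addr0 scaleN1r addNr.
Qed.

(** Expand both arguments over the sets K1 and K2 by partition_expansionD. By
    bilinearity the product is a combination of the expansions of K1 :|: K2 with
    weight g, and partition_sumU merges the coefficients. The pairs (K1, K2)
    correspond to K = K1 :|: K2. *)
Lemma partition_expansionU (R : comNzRingType) (V : finType) (M : lmodType R)
    (x : {set V} -> M) (W : M -> M -> M) (f g : {set V} -> R) (S1 S2 : {set V}) :
  (forall p, linear (W p)) -> (forall q, linear (W^~ q)) ->
  (forall K1 K2 : {set V}, [disjoint K1 & K2] ->
     W (partition_expansion x g K1) (partition_expansion x g K2) =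
     partition_expansion x g (K1 :|: K2)) ->
  [disjoint S1 & S2] ->
  (forall B : {set V}, B \subset S1 :|: S2 ->
     ~~ (B \subset S1) -> ~~ (B \subset S2) -> f B = 0) ->
  W (partition_expansion x (fun B => f B + g B) S1)
    (partition_expansion x (fun B => f B + g B) S2) =
  partition_expansion x (fun B => f B + g B) (S1 :|: S2).
Proof.
move=> Wr Wl Wg S12 f0; rewrite !partition_expansionD.
rewrite (linear_sumZ _ _ _ _ (Wl _)).
under eq_bigr => K1 K1S.
  rewrite (linear_sumZ _ _ _ _ (Wr _)) scaler_sumr.
  over.
rewrite pair_big_dep /=.
rewrite (reindex_onto (fun K : {set V} => (K :&: S1, K :&: S2))
  (fun p => p.1 :|: p.2)) /=.
  have cap (K : {set V}) : K \subset S1 :|: S2 -> K :&: S1 :|: K :&: S2 = K.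
    by move=> KS; rewrite -setIUr; apply/setIidPl.
  apply: eq_big => [K|K].
    rewrite !subsetIr /=; apply/eqP/idP => [<-|/cap //].
    by rewrite setUSS ?subsetIr.
  rewrite !subsetIr /= => /eqP KE.
  have dis (K1 K2 : {set V}) :
      K1 \subset S1 -> K2 \subset S2 -> [disjoint K1 & K2].
    by move=> K1S K2S; apply: disjointWl K1S (disjointWr K2S S12).
  rewrite Wg ?dis ?subsetIr // KE scalerA.
  rewrite -partition_sumU ?dis ?subsetDl //; last first.
    move=> B BS nB1 nB2; apply: f0.
    - exact: subset_trans BS (setUSS (subsetDl _ _) (subsetDl _ _)).
    - apply: contra nB1 => /subsetP B1; apply/subsetP => y yB.
      have := subsetP BS y yB; rewrite inE => /orP[//|/setDP[]].
      by rewrite (disjointFr S12) // B1.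
    apply: contra nB2 => /subsetP B2; apply/subsetP => y yB.
    have := subsetP BS y yB; rewrite inE => /orP[/setDP[]|//].
    by rewrite (disjointFl S12) // B2.
  by rewrite !setDIr !setDv !setU0 -setDUl.
move=> [K1 K2] /andP[/= K1S K2S]; move: S12; rewrite -setI_eq0 => /eqP S12.
congr (_, _); rewrite setIUl.
  rewrite (setIidPl K1S); apply/setUidPl/subset_trans/sub0set.
  by rewrite -S12 setIC setIS.
rewrite (setIidPl K2S); apply/setUidPr/subset_trans/sub0set.
by rewrite -S12 setSI.
Qed.

(** * Transport along injections of the nodes *)

Section Relabelling.
Context (U V : finType) (h : U -> V) (h_inj : injective h).

Lemma reindex_subsets (M : nmodType) (F : {set V} -> M) (S : {set U}) :
  \sum_(J : {set V} | J \subset h @: S) F J =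
  \sum_(J : {set U} | J \subset S) F (h @: J).
Proof.
rewrite (reindex_onto (fun J : {set U} => h @: J)
  (fun J : {set V} => h @^-1: J)) /=; last first.
  move=> J JS; apply/setP => v; apply/imsetP/idP => [[u]|vJ].
    by rewrite inE => uJ ->.
  have /imsetP[u uS vE] := subsetP JS v vJ.
  by exists u; rewrite // inE -vE.
apply: eq_bigl => J; rewrite (_ : h @^-1: _ = J) ?eqxx ?andbT.
  apply/subsetP/subsetP => JS => [u uJ|_ /imsetP[u uJ ->]].
    by rewrite -(mem_imset _ _ h_inj); apply: JS; apply: imset_f.
  by rewrite mem_imset //; apply: JS.
by apply/setP => u; rewrite inE mem_imset.
Qed.

Lemma partition_expansion_imset (R : comNzRingType) (M : lmodType R)
    (x : {set V} -> M) (f : {set V} -> R) (S : {set U}) :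
  partition_expansion x f (h @: S) =
  partition_expansion (fun J : {set U} => x (h @: J))
    (fun B : {set U} => f (h @: B)) S.
Proof.
rewrite /partition_expansion reindex_subsets; apply: eq_bigr => J JS.
congr (_ *: _); rewrite /partition_sum.
have -> : h @: S :\: h @: J = h @: (S :\: J).
  apply/setP => v; apply/idP/imsetP => [/setDP[/imsetP[u uS ->]]|[u + ->]].
    by rewrite mem_imset // => uJ; exists u; rewrite ?inE ?uJ.
  by rewrite !inE !mem_imset.
rewrite reindex_partition_sum //; apply: eq_bigr => pi _.
by rewrite big_imset //= => B C _ _; apply: imset_inj.
Qed.

Context (d : measure_display) (T : measurableType d) (R : realType).
Context (P : probability T R).

Lemma joint_cumulant_imset (Y : V -> {RV P >-> R}) (S : {set U}) :
  joint_cumulant Y (h @: S) = joint_cumulant (Y \o h) S.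
Proof.
rewrite /joint_cumulant reindex_partition_sum //; apply: eq_bigr => pi _.
have him : injective (fun B : {set U} => h @: B) by apply: imset_inj.
rewrite card_imset // big_imset /=; last by move=> ? ? _ _; apply: him.
congr (_ * _); apply: eq_bigr => B _; rewrite /joint_moment.
congr (fine 'E_P[_]); apply/funext => w.
by rewrite big_imset //= => ? ? _ _; apply: h_inj.
Qed.

Lemma npow_imset (I : choiceType) (l : V -> I) (S : {set U}) :
  npow R l (h @: S) = npow R (l \o h) S.
Proof. by rewrite /npow big_imset //= => ? ? _ _; apply: h_inj. Qed.

End Relabelling.

Lemma perm_eq_map_r (S T : eqType) (l : T -> S) (s : seq S) (t : seq T) :
  perm_eq s (map l t) -> exists2 r, perm_eq r t & s = map l r.
Proof.
case: t => [|v0 t]; first by move/perm_nilP => ->; exists [::].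
move=> /(perm_iotaP (l v0))[Is]; rewrite size_map => IsP ->.
exists (map (nth v0 (v0 :: t)) Is).
  by rewrite -[X in perm_eq _ X](mkseq_nth v0); apply: perm_map.
rewrite -map_comp; apply/eq_in_map => i.
rewrite (perm_mem IsP) mem_iota add0n => /andP[_ it].
exact: nth_map.
Qed.

(** * Appell polynomials and their Wick products on a fixed set of nodes *)

Section AppellOnNodes.
Context (d : measure_display) (T : measurableType d) (R : realType).
Context (P : probability T R) (I : choiceType) (X : I -> {RV P >-> R}).
Context (V : finType) (l : V -> I).

(** Indexing Appell polynomials by sets of nodes of a fixed V, rather than by
    multisets, turns multiset sums into disjoint unions inside V. *)
Definition node_appell (K : {set V}) : polyalg R I :=
  partition_expansion (npow R l) (fun B => - joint_cumulant (X \o l) B) K.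

Definition label_mset (K : {set V}) : {mset I} :=
  seq_mset [seq l v | v <- enum K].

Lemma label_msetU (K1 K2 : {set V}) : [disjoint K1 & K2] ->
  label_mset (K1 :|: K2) = (label_mset K1 `+` label_mset K2)%mset.
Proof.
move=> K12; apply/msetP => i; rewrite msetE2 !mset_seqE -count_cat -map_cat.
apply/permP/perm_map/uniq_perm; first exact: enum_uniq.
  rewrite cat_uniq !enum_uniq andbT /=; apply/hasPn => v.
  by rewrite !mem_enum => vK2; rewrite (disjointFl K12).
by move=> v; rewrite mem_cat !mem_enum inE.
Qed.

End AppellOnNodes.

Lemma appell_node_appell (d : measure_display) (T : measurableType d)
    (R : realType) (P : probability T R) (I : choiceType)
    (X : I -> {RV P >-> R}) (A : {mset I}) :
  appell X A = node_appell X (@label I A) [set: node A].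
Proof.
rewrite /appell /node_appell /partition_expansion.
apply: eq_big => [J|J _]; first by rewrite subsetT.
rewrite setTD; apply: (congr1 (fun c => c *: npow R (@label I A) J)).
by apply: eq_bigr => pi _; rewrite prodrN.
Qed.

Section WickOnNodes.
Context (d : measure_display) (T : measurableType d) (R : realType).
Context (P : probability T R) (I : choiceType) (X : I -> {RV P >-> R}).

Lemma node_appell_imset (U V : finType) (h : U -> V) (l : V -> I) (S : {set U}) :
  injective h -> node_appell X l (h @: S) = node_appell X (l \o h) S.
Proof.
move=> h_inj; rewrite /node_appell (partition_expansion_imset h_inj).
apply: eq_partition_expansion => [J|B _ _]; first exact: npow_imset.
by rewrite joint_cumulant_imset.
Qed.

(** The nodes of the multiset of labels of K are numbered in the order of its
    canonical enumeration, which is the sequence of labels along some listing r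
    of K. Reading r gives a label-preserving injection h with image K. *)
Lemma appell_label_mset (V : finType) (l : V -> I) (K : {set V}) :
  appell X (label_mset l K) = node_appell X l K.
Proof.
rewrite appell_node_appell.
have [r rK sE] := perm_eq_map_r (perm_eq_seq_mset [seq l v | v <- enum K]).
have szE : size (label_mset l K) = size r by rewrite sE size_map.
pose h (u : node (label_mset l K)) : V := tnth (in_tuple r) (cast_ord szE u).
have h_inj : injective h.
  move=> u1 u2 /eqP; rewrite /h !(tnth_nth (h u1)) /=.
  rewrite nth_uniq -?szE // ?(perm_uniq rK) ?enum_uniq // => /eqP.
  exact: val_inj.
have hK : h @: [set: node (label_mset l K)] = K.
  apply/setP => v; rewrite -(mem_enum K) -(perm_mem rK).
  apply/imsetP/idP => [[u _ ->]|vr]; first exact: mem_tnth.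
  have vi : (index v r < size (label_mset l K))%N by rewrite szE index_mem.
  exists (Ordinal vi); rewrite ?inE // /h (tnth_nth v) /=.
  by rewrite nth_index.
have -> : @label I (label_mset l K) = l \o h.
  apply/funext => u; rewrite /= /label (tnth_nth (l (h u))) /=.
  rewrite (congr1 (fun s => nth (l (h u)) s u) sE).
  rewrite (nth_map (h u)) -?szE //; congr l.
  by rewrite /h [RHS](tnth_nth (h u)).
by rewrite -(node_appell_imset _ _ h_inj) hK.
Qed.

Lemma wick_node_appell (V : finType) (l : V -> I) (K1 K2 : {set V}) :
  [disjoint K1 & K2] ->
  wick X (node_appell X l K1) (node_appell X l K2) = node_appell X l (K1 :|: K2).
Proof.
have [_ _ wickE] := wickP X.
by move=> K12; rewrite -!appell_label_mset wickE label_msetU.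
Qed.

End WickOnNodes.

(** * Rows and flat blocks *)

Section Rows.
Context (d : measure_display) (T : measurableType d) (R : realType).
Context (P : probability T R) (I : choiceType) (X : I -> {RV P >-> R}).
Context (m : nat) (A : 'I_m -> {mset I}).

Let c : {set node_sum A} -> R := joint_cumulant (X \o @label_sum I m A).

Definition flat (B : {set node_sum A}) : bool :=
  [exists k : 'I_m, [forall v in B, tag v == k]].

Definition rows (s : seq 'I_m) : {set node_sum A} := [set v | tag v \in s].

Lemma mpow_row (k : 'I_m) :
  mpow R (A k) = npow R (@label_sum I m A) (rows [:: k]).
Proof.
pose h (u : node (A k)) : node_sum A := Tagged (fun k => node (A k)) u.
have h_inj : injective h by move=> u1 u2 /eqP; rewrite /h eq_Tagged => /eqP.
have -> : rows [:: k] = h @: [set: node (A k)].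
  apply/setP => -[j v]; rewrite !inE /=.
  apply/eqP/imsetP => [jk|[u _ /(congr1 tag)] //].
  by move: v; rewrite jk => v; exists v; rewrite ?inE.
rewrite (npow_imset h_inj) /mpow /npow big_tnth.
by apply: eq_bigl => v; rewrite inE.
Qed.

Lemma flat_rowsU (k : 'I_m) (s : seq 'I_m) (B : {set node_sum A}) :
  B \subset rows [:: k] :|: rows s -> flat B ->
  (B \subset rows [:: k]) || (B \subset rows s).
Proof.
move=> BU /existsP[j /'forall_implyP Bj].
have [->|/set0Pn[v vB]] := eqVneq B set0; first by rewrite sub0set.
have := subsetP BU v vB; rewrite !inE (eqP (Bj v vB)) => jks.
apply/orP; case/orP: jks => jks; [left|right]; apply/subsetP => w wB;
  by rewrite !inE (eqP (Bj w wB)).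
Qed.

(** This is - c on non-flat blocks and 0 on flat ones, written as the sum of the
    weight c of the flat blocks and of the weight - c of the Appell
    polynomials. *)
Definition nonflat_weight (B : {set node_sum A}) : R :=
  (if flat B then c B else 0) - c B.

(** Inside one row every block is flat, so the monomial of the row is its own
    expansion with the non-flat weight; partition_expansionU then adds one row
    at a time. *)
Lemma wick_rows (s : seq 'I_m) : uniq s ->
  \big[wick X / 1]_(k <- s) mpow R (A k) =
  partition_expansion (npow R (@label_sum I m A)) nonflat_weight (rows s).
Proof.
have [wickr wickl _] := wickP X.
elim: s => [_|k s IH /= /andP[ks us]].
  have -> : rows [::] = set0 by apply/setP => v; rewrite !inE.
  rewrite big_nil partition_expansion0 /npow ?big_set0 // => B B0.
  by rewrite subset0 (negPf B0).
have -> : rows (k :: s) = rows [:: k] :|: rows s.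
  by apply/setP => v; rewrite !inE.
rewrite big_cons {}IH // mpow_row.
rewrite -[npow _ _ _](@partition_expansion0 _ _ _ _ nonflat_weight); last first.
  move=> B _ Bk; rewrite /nonflat_weight ifT ?subrr //; apply/existsP; exists k.
  by apply/'forall_implyP => v /(subsetP Bk); rewrite !inE.
apply: partition_expansionU => //.
- exact: wick_node_appell.
- rewrite -setI_eq0; apply/eqP/setP => v; rewrite !inE.
  by apply/andP => -[/eqP -> ]; apply/negP.
- move=> B BU B1 B2; case: ifP => // Bf.
  by have := flat_rowsU BU Bf; rewrite (negPf B1) (negPf B2).
Qed.

Lemma nonflat_expansion :
  partition_expansion (npow R (@label_sum I m A)) nonflat_weight
    [set: node_sum A] =
  \sum_(D in diagramNF A)
    ((-1) ^+ #|D.1| * kappa_part (X \o @label_sum I m A) D.1)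
      *: npow R (@label_sum I m A) D.2.
Proof.
rewrite (@eq_partition_expansion _ _ _ _ (npow R (@label_sum I m A)) _
  (fun B => if flat B then 0 else - c B)) //; last first.
  by move=> B _ _; rewrite /nonflat_weight; case: ifP; rewrite ?subrr ?sub0r.
rewrite partition_expansionT_nonflat.
by apply: eq_bigl => -[pi J]; rewrite inE.
Qed.

End Rows.

Theorem theorem1p10 (d : measure_display) (T : measurableType d) (R : realType)
    (P : probability T R) (I : choiceType) (X : I -> {RV P >-> R})
    (hX : finite_mixed_moments X) (m : nat) (A : 'I_m -> {mset I}) :
  \big[wick X / 1]_(k < m) mpow R (A k) =
  \sum_(D in diagramNF A)
    ((-1) ^+ #|D.1| * kappa_part (X \o @label_sum I m A) D.1)
      *: npow R (@label_sum I m A) D.2.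
Proof.
rewrite wick_rows ?index_enum_uniq // -nonflat_expansion.
congr partition_expansion; apply/setP => v.
by rewrite !inE mem_index_enum.
Qed.
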